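(* For every integer $q\ge 1$ there is a constant $c_1=c_1(q)>0$ such that for all sufficiently large $n$, $$r_e(\vec{P}_n, q+1)\ \ge\ \frac{c_1\, n^{2q}(\log n)^{1/q}}{(\log\log n)^{(q+2)/q}},$$ where $r_e(\vec P_n,q+1)$ is the size Ramsey number in oriented graphs defined in the context. Equivalently: every oriented graph with fewer than $\frac{c_1 n^{2q}(\log n)^{1/q}}{(\log\log n)^{(q+2)/q}}$ edges admits a coloring of its edges with $q+1$ colors containing no monochromatic copy of $\vec P_n$.
   Context: An oriented graph is a directed graph with no loops, no parallel edges and no pair of antiparallel edges (i.e. for any two vertices $u,v$ at most one of $(u,v),(v,u)$ is an edge). $\vec P_n$ denotes the directed path on $n$ vertices. For a directed graph $H$ and integer $r\ge1$, $r_e(H,r)$ (in oriented graphs) is the minimum number $m$ such that there is an oriented graph $G$ with $m$ edges for which every coloring of $E(G)$ with $r$ colors contains a monochromatic copy of $H$ (a directed path all of whose edges have the same color, oriented consistently). Logarithms are base $2$. *)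

(* Defs.v *)
From HB Require Import structures.
From mathcomp Require Import all_boot all_order all_algebra.
From mathcomp Require Import all_classical all_reals all_analysis.

Set Implicit Arguments.
Unset Strict Implicit.
Unset Printing Implicit Defensive.

Import Order.TTheory GRing.Theory Num.Theory.

Local Open Scope ring_scope.

Record digraph := Digraph { vertex :> finType; arc : rel vertex }.

Definition edges (G : digraph) : {set G * G} := [set p | arc p.1 p.2].

Definition oriented (G : digraph) : Prop :=
  (forall u : G, ~~ arc u u) /\
  (forall u v : G, ~~ (arc u v && arc v u)).

(* A colouring is given on all pairs of vertices; only its values on edges of G
   are ever used, so for r > 0 this is the same as a colouring of [edges G]. *)
Definition has_mono_copy (H G : digraph) (r : nat) (c : G -> G -> 'I_r) : Prop :=
  exists (k : 'I_r) (f : H -> G),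
    injective f /\
    forall u v : H, arc u v -> arc (f u) (f v) /\ c (f u) (f v) = k.

Definition arrows (G H : digraph) (r : nat) : Prop :=
  forall c : G -> G -> 'I_r, has_mono_copy H c.

Definition ramsey_size (H : digraph) (r m : nat) : Prop :=
  exists G : digraph, [/\ oriented G, #|edges G| = m & arrows G H r].

(* The minimum of [ramsey_size H r]; by convention 0 if no oriented graph G
   satisfies [arrows G H r] (for instance, if H is not itself oriented). *)
Definition size_ramsey (H : digraph) (r : nat) : nat :=
  xget 0%N (fun m => ramsey_size H r m /\
                     forall m', ramsey_size H r m' -> (m <= m')%N).

(* The directed path with n vertices (hence n - 1 edges). *)
Definition dipath (n : nat) : digraph :=
  @Digraph 'I_n (fun i j => j == i.+1 :> nat).

Definition log2 {R : realType} (x : R) : R := ln x / ln 2.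

(* Main.v *)
(* Call a vertex set layered with h layers if its vertices carry labels below h
   that strictly increase along arcs.  Suppose the vertices split into M layered
   sets, with M <= k^q and h <= t^(q+1).  Write the index of the set in base k and
   the label in base t.  An arc between two sets gets the colour of a base-k digit
   that increases, or the last colour if no digit does; an arc inside a set gets
   the colour of a base-t digit that increases.  Then no monochromatic path has
   more than q*k*t vertices, so it suffices to split a graph with N^2 arcs into
   O(N / T) layered sets with 2T layers, where T is about log N / log log N.

   Vertices of degree below N / T are coloured greedily, and at most 2NT vertices
   remain.  From x remaining vertices a layered set of order T * max(1, x^2 / N^2)
   is extracted as follows, in the spirit of the Erdos-Szemeredi theorem.  Run k
   clusters W_1, ..., W_k, all initially the whole set.  In each of T rounds pick a
   random pivot in every cluster, and replace every W_i by the class of a random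
   point of W_i for the equivalence "same adjacencies to the pivots".  The expected
   density between different clusters does not change, while the clusters shrink
   slowly since a class is described by few adjacencies.  After T rounds most
   pivots have no arc to the pivots of other clusters, and the pivots of one
   cluster form a transitive chain. *)

From HB Require Import structures.
From mathcomp Require Import all_boot all_order all_algebra.
From mathcomp Require Import zify ring lra.

Set Implicit Arguments.
Unset Strict Implicit.
Unset Printing Implicit Defensive.

Import Order.TTheory GRing.Theory Num.Theory.

Local Open Scope ring_scope.

(** * Averages over finite sets *)

Section Averages.
Variables (R : realFieldType) (V I : finType).
Implicit Types (W : {set V}) (g : V -> R) (X : I -> {set V}).

Definition mu W (u : V) : R := (u \in W)%:R / #|W|%:R.

Definition avg W g : R := \sum_u mu W u * g u.

Definition pavg X (F : {ffun I -> V} -> R) : R :=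
  \sum_(x : {ffun I -> V}) (\prod_i mu (X i) (x i)) * F x.

Lemma mu_ge0 W u : 0 <= mu W u.
Proof. by rewrite divr_ge0 // ler0n. Qed.

Lemma mem_of_mu W u : mu W u != 0 -> u \in W.
Proof. by rewrite /mu; case: (u \in W) => //; rewrite mul0r eqxx. Qed.

Lemma avgE W g : avg W g = (\sum_(u in W) g u) / #|W|%:R.
Proof.
rewrite /avg [in RHS]big_mkcond /= mulr_suml; apply: eq_bigr => u _.
by rewrite /mu; case: (u \in W); rewrite ?mul0r // mul1r mulrC.
Qed.

Lemma avg_cst W c : W != set0 -> avg W (fun=> c) = c.
Proof.
move=> W0; rewrite avgE sumr_const -[c *+ _]mulr_natr mulfK //.
by rewrite pnatr_eq0 cards_eq0.
Qed.

Lemma eq_avg W g g' : {in W, g =1 g'} -> avg W g = avg W g'.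
Proof. by move=> e; rewrite !avgE; congr (_ / _); apply: eq_bigr. Qed.

Lemma avg_sum (J : finType) (P : pred J) W (g : J -> V -> R) :
  avg W (fun u => \sum_(j | P j) g j u) = \sum_(j | P j) avg W (g j).
Proof. by rewrite /avg exchange_big; apply: eq_bigr => u _; rewrite mulr_sumr. Qed.

Lemma avgC W W' (g : V -> V -> R) :
  avg W (fun u => avg W' (g u)) = avg W' (fun v => avg W (g^~ v)).
Proof.
rewrite /avg; under eq_bigr do rewrite mulr_sumr.
rewrite exchange_big; apply: eq_bigr => v _; rewrite mulr_sumr.
by apply: eq_bigr => u _; rewrite mulrCA.
Qed.

Section Fibres.
Variables (P : finType) (f : V -> P).

Definition fibre W (y : V) : {set V} := [set w in W | f w == f y].

Lemma fibre_self W y : y \in W -> y \in fibre W y.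
Proof. by move=> yW; rewrite inE yW /=. Qed.

Lemma card_fibre_gt0 W y : y \in W -> (0 < #|fibre W y|)%N.
Proof. by move=> yW; apply/card_gt0P; exists y; exact: fibre_self. Qed.

(** Resampling a uniform point inside its own class leaves it uniform: [w] is reached from exactly
    [#|fibre W w|] choices of [y], each time with probability 1 / [#|fibre W w|]. *)
Lemma avg_fibre W g : avg W (fun y => avg (fibre W y) g) = avg W g.
Proof.
rewrite !avgE; congr (_ / _); under eq_bigr => y _ do rewrite avgE mulr_suml.
have sw y : \sum_(w in fibre W y) g w / #|fibre W y|%:R =
   \sum_(w in W) (if f w == f y then g w / #|fibre W w|%:R else 0).
  rewrite [RHS]big_mkcond [LHS]big_mkcond; apply: eq_bigr => w _; rewrite inE.
  case: (w \in W) => //=; case: eqP => // e; congr (_ / _%:R); apply: eq_card => v.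
  by rewrite !inE e.
under eq_bigr => y _ do rewrite sw.
rewrite exchange_big; apply: eq_bigr => w wW.
rewrite -big_mkcondr sumr_const.
have -> : #|[pred y in W | f w == f y]| = #|fibre W w|.
  by apply: eq_card => y; rewrite !inE eq_sym.
rewrite -[_ *+ _]mulr_natr mulfVK // pnatr_eq0 -lt0n; exact: card_fibre_gt0.
Qed.

(** A class that meets [W] contributes exactly [Q p / #|W|], whatever its size; the inequality is
    strict only through values [p] not attained on [W]. *)
Lemma avg_inv_fibre W (Q : P -> R) : (forall p, 0 <= Q p) ->
  avg W (fun y => Q (f y) / #|fibre W y|%:R) <= (\sum_p Q p) / #|W|%:R.
Proof.
move=> Q0; rewrite avgE ler_wpM2r ?invr_ge0 ?ler0n //.
rewrite (partition_big f xpredT) //=; apply: ler_sum => p _.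
case: (pickP [pred y in W | f y == p]) => [y0 /andP[/= y0W /eqP fy0]|no]; last first.
  by rewrite big1 // => y; have := no y; rewrite inE => ->.
have -> : \sum_(y in W | f y == p) Q (f y) / #|fibre W y|%:R =
          \sum_(y in fibre W y0) Q p / #|fibre W y0|%:R.
  apply: eq_big => [y|y /andP[_ /eqP e]]; first by rewrite inE fy0.
  by rewrite e; congr (_ / _%:R); apply: eq_card => v; rewrite !inE e fy0.
rewrite sumr_const -[_ *+ _]mulr_natr mulfVK // pnatr_eq0 -lt0n.
exact: card_fibre_gt0.
Qed.

End Fibres.

Lemma pavg_prod X (h : I -> V -> R) :
  pavg X (fun x => \prod_i h i (x i)) = \prod_i avg (X i) (h i).
Proof.
rewrite /avg bigA_distr_bigA; apply: eq_bigr => x _.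
by rewrite -big_split.
Qed.

Lemma pavg_sum (J : finType) (P : pred J) X (F : J -> {ffun I -> V} -> R) :
  pavg X (fun x => \sum_(j | P j) F j x) = \sum_(j | P j) pavg X (F j).
Proof. by rewrite /pavg exchange_big; apply: eq_bigr => u _; rewrite mulr_sumr. Qed.

Lemma pavgZ X c F : pavg X (fun x => c * F x) = c * pavg X F.
Proof. by rewrite /pavg mulr_sumr; apply: eq_bigr => x _; rewrite mulrCA. Qed.

Lemma pavgD X F G : pavg X (fun x => F x + G x) = pavg X F + pavg X G.
Proof. by rewrite /pavg -big_split; apply: eq_bigr => x _; rewrite mulrDr. Qed.

Lemma eq_pavg X F G : F =1 G -> pavg X F = pavg X G.
Proof. by move=> e; apply: eq_bigr => x _; rewrite e. Qed.

Lemma pavg_proj1 X i g : (forall i, X i != set0) ->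
  pavg X (fun x => g (x i)) = avg (X i) g.
Proof.
move=> X0; pose h l v := if l == i then g v else 1.
rewrite (_ : avg _ _ = \prod_l avg (X l) (h l)).
  rewrite -pavg_prod; apply: eq_pavg => x.
  by rewrite (bigD1 i) //= {1}/h eqxx big1 ?mulr1 // => l /negPf li; rewrite /h li.
rewrite (bigD1 i) //= big1 ?mulr1 => [|l /negPf li].
  by apply: eq_avg => v _; rewrite /h eqxx.
by rewrite -[RHS](avg_cst 1 (X0 l)); apply: eq_avg => v _; rewrite /h li.
Qed.

Lemma pavg_cst X c : (forall i, X i != set0) -> pavg X (fun=> c) = c.
Proof.
move=> X0; rewrite -[RHS]mulr1 -[c in LHS]mulr1 pavgZ; congr (_ * _).
transitivity (\prod_(i : I) avg (X i) (fun=> 1)).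
  by rewrite -(pavg_prod X (fun _ _ => 1)); apply: eq_pavg => x; rewrite big1.
by rewrite big1 // => i _; exact: avg_cst.
Qed.

Lemma pavg_proj2 X i j (g : V -> V -> R) : (forall i, X i != set0) -> i != j ->
  pavg X (fun x => g (x i) (x j)) = avg (X i) (fun u => avg (X j) (g u)).
Proof.
(* Summing over the value [u] of [x i] with an indicator turns [g (x i) (x j)] into a sum of
   products, to which [pavg_prod] applies. *)
move=> X0 ij; pose h u l v := if l == i then (v == u)%:R else if l == j then g u v else 1.
have e u : avg (X i) (fun v => (v == u)%:R) * avg (X j) (g u) = \prod_l avg (X l) (h u l).
  rewrite (bigD1 i) //= (bigD1 j) ?(eq_sym j) //= big1 ?mulr1 => [|l /andP[/negPf li /negPf lj]].
    by congr (_ * _); apply: eq_avg => v _; rewrite /h ?eqxx // eq_sym (negPf ij).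
  by rewrite -[RHS](avg_cst 1 (X0 l)); apply: eq_avg => v _; rewrite /h li lj.
transitivity (pavg X (fun x => \sum_u \prod_l h u l (x l))).
  apply: eq_pavg => x; rewrite (bigD1 (x i)) //= [X in _ + X]big1 => [|u /negPf ux]; last first.
    by rewrite (bigD1 i) //= /h eqxx eq_sym ux mul0r.
  rewrite addr0 (bigD1 i) //= (bigD1 j) ?(eq_sym j) //= big1 => [|l /andP[/negPf li /negPf lj]].
    by rewrite /h !eqxx eq_sym (negPf ij) mulr1 mul1r.
  by rewrite /h li lj.
rewrite pavg_sum; under eq_bigr do rewrite pavg_prod -e.
rewrite {3}/avg; apply: eq_bigr => u _; congr (_ * _).
rewrite /avg (bigD1 u) //= eqxx mulr1 big1 ?addr0 // => v /negPf ->; exact: mulr0.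
Qed.

Lemma pavg_exists X F (b : R) : (forall i, X i != set0) -> pavg X F <= b ->
  exists2 x : {ffun I -> V}, (forall i, x i \in X i) & F x <= b.
Proof.
move=> X0; case: (pickP [pred x : {ffun I -> V} | [forall i, x i \in X i] && (F x <= b)]) => [x|no].
  by case/andP=> /= /forallP xX Fb _; exists x.
suff: b < pavg X F by move/lt_le_trans => h /h; rewrite ltxx.
have w0 (x : {ffun I -> V}) : 0 <= \prod_i mu (X i) (x i).
  by apply: prodr_ge0 => i _; exact: mu_ge0.
have t0 (x : {ffun I -> V}) : 0 <= (\prod_i mu (X i) (x i)) * (F x - b).
  have [->|nz] := eqVneq (\prod_i mu (X i) (x i)) 0; first by rewrite mul0r.
  rewrite mulr_ge0 // subr_ge0 ltW // ltNge; apply/negP => Fb.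
  have := no x; rewrite /= Fb andbT => /forallP; apply => i.
  by apply: mem_of_mu; move/prodf_neq0: nz; apply.
have sumE : pavg X F = b + pavg X (fun x => F x - b).
  by rewrite -{1}(pavg_cst b X0) -pavgD; apply: eq_pavg => x; rewrite addrC subrK.
(* If the mean were exactly [b], all these nonnegative terms would vanish; since [F] exceeds [b]
   wherever the weight is nonzero, all weights would be 0, against total mass 1. *)
rewrite sumE ltrDl lt_neqAle sumr_ge0 // andbT eq_sym; apply/negP => /eqP z.
have {}z := psumr_eq0P (fun x _ => t0 x) z.
have : pavg X (fun=> 1) = 0.
  rewrite /pavg big1 // => x _; rewrite mulr1; apply/eqP/contraT => nz.
  have /eqP := z x isT; rewrite mulf_eq0 (negPf nz) /= subr_eq0 => /eqP Fb.
  have := no x; rewrite /= Fb lexx andbT => /forallP; case => i.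
  by apply: mem_of_mu; move/prodf_neq0: nz; apply.
by rewrite pavg_cst // => /eqP; rewrite oner_eq0.
Qed.

End Averages.

(** * The pivoting process *)

Section Process.
Variables (R : realFieldType) (V I : finType) (arc : rel V).
Implicit Types (X Y : I -> {set V}) (x y w : {ffun I -> V}).

(** Equality is included so that pivots of different clusters that are not similar are also
    distinct. *)
Definition sim : rel V := fun u v => [|| u == v, arc u v | arc v u].

Lemma sim_sym u v : sim u v = sim v u.
Proof. by rewrite /sim eq_sym [arc u v || _]orbC. Qed.

Definition nadj i x (v : V) : nat := \sum_(j | j != i) sim v (x j).

(** Towards other clusters similarity is enough, because pivots similar across clusters are
    discarded later; towards the own pivot the direction is kept, since it decides the layers. *)
Definition pattern i x (v : V) : {ffun I -> bool} * (bool * bool) :=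
  ([ffun j => (j != i) && sim v (x j)], (v == x i, arc v (x i))).

Definition crossdens X : R :=
  \sum_i \sum_(j | j != i) avg (X i) (fun u => avg (X j) (fun v => (sim u v)%:R)).

Definition cell X x y i : {set V} := fibre (pattern i x) (X i) (y i).

(* Product weights on patterns with total mass bounded by 8; they turn
   [avg_inv_fibre] into a supermartingale bound on 1 / #|W_i|. *)
Definition weight (p : {ffun I -> bool} * (bool * bool)) : R :=
  \prod_j (if p.1 j then (2 * #|I|%:R)^-1 else 1).

Lemma weight_ge0 p : 0 <= weight p.
Proof. by apply: prodr_ge0 => j _; case: ifP => // _; rewrite invr_ge0 -natrM ler0n. Qed.

Lemma weight_pattern i x v : weight (pattern i x v) = (2 * #|I|%:R) ^- nadj i x v.
Proof.
rewrite /weight /nadj -exprVn -[RHS]mulr1 -prodrXr [in RHS]big_mkcond /= mulr1.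
apply: eq_bigr => j _; rewrite ffunE.
by case: (j != i) => //=; case: (sim _ _).
Qed.

Lemma sum_weight : \sum_p weight p <= 8.
Proof.
pose a : R := (2 * #|I|%:R)^-1.
have -> : \sum_p weight p = \sum_(f : {ffun I -> bool}) \sum_(b : bool * bool) weight (f, b).
  by rewrite pair_big /=; apply: eq_bigr => -[].
have -> : \sum_(f : {ffun I -> bool}) \sum_(b : bool * bool) weight (f, b) = 4 * (a + 1) ^+ #|I|.
  under eq_bigr => f _ do rewrite /weight /= sumr_const card_prod card_bool -[_ *+ (2 * 2)]mulr_natl.
  rewrite -mulr_sumr.  congr (_ * _).
  transitivity (\prod_(j : I) \sum_(b : bool) (if b then a else 1)).
    by rewrite bigA_distr_bigA.
  by rewrite prodr_const big_bool.
suff: (a + 1) ^+ #|I| <= 2 by lra.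
have [->|k0] := posnP #|I|; first by rewrite expr0 ler1n.
have k1 : (1 : R) <= #|I|%:R by rewrite ler1n.
have a0 : 0 <= a by rewrite invr_ge0; lra.
(* Bernoulli's inequality for 1 - 1 / (2k + 1), the inverse of [a + 1]: its k-th power is at least
   (k + 1) / (2k + 1) >= 1 / 2. *)
pose k : R := #|I|%:R; have bern n : 1 - n%:R / (2 * k + 1) <= (1 - (2 * k + 1)^-1) ^+ n.
  elim: n => [|n IH]; first by rewrite mul0r subr0 expr0.
  have h : 0 <= (2 * k + 1)^-1 <= 1.
    by rewrite invr_ge0 invf_le1; rewrite /k; lra.
  have n0 : (0 : R) <= n%:R by exact: ler0n.
  rewrite exprS; apply: le_trans (ler_wpM2l _ IH); last by lra.
  rewrite -natr1; nra.
have e : (1 - (2 * k + 1)^-1) * (a + 1) = 1.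
  by rewrite /a -/k; field; rewrite /k; lra.
have := bern #|I|; rewrite -/k => b.
have b2 : 2^-1 <= 1 - k / (2 * k + 1).
  have -> : 1 - k / (2 * k + 1) = (k + 1) / (2 * k + 1) by field; rewrite /k; lra.
  by rewrite ler_pdivlMr; rewrite /k; lra.
have p0 : 0 <= (a + 1) ^+ #|I| by rewrite exprn_ge0 //; lra.
have := ler_wpM2r p0 (le_trans b2 b); rewrite -exprMn e expr1n; lra.
Qed.

(* Only different clusters are compared, and their points are drawn
   independently: this is why the expected density is preserved exactly. *)
Lemma crossdens_cell X x : (forall i, X i != set0) ->
  pavg X (fun y => crossdens (cell X x y)) = crossdens X.
Proof.
move=> X0; rewrite /crossdens pavg_sum; apply: eq_bigr => i _.
rewrite pavg_sum; apply: eq_bigr => j ji.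
rewrite /cell (pavg_proj2 (fun u u' => avg (fibre (pattern i x) (X i) u)
   (fun a => avg (fibre (pattern j x) (X j) u') (fun b => (sim a b)%:R)))) // 1?eq_sym //.
under eq_avg => u _.
  rewrite avgC; under eq_avg => a _ do rewrite avg_fibre.
  over.
by rewrite avg_fibre.
Qed.

(** First moment method, applied to the pivots [x] and then to the representatives [y]. Both
    adjacency counts have mean [crossdens X], whence [2 * al]; the inverse sizes, damped by
    [weight / 8], do not grow in mean. *)
Lemma process_step X (z : I -> R) (al be : R) : (forall i, X i != set0) ->
    (forall i, 0 <= z i) ->
  exists x y, [/\ forall i, x i \in X i, forall i, y i \in X i &
    al * (\sum_i (nadj i x (y i) + nadj i x (x i))%:R) + be * crossdens (cell X x y)
      + \sum_i z i * weight (pattern i x (y i)) / 8 / #|cell X x y i|%:R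
    <= (2 * al + be) * crossdens X + \sum_i z i / #|X i|%:R].
Proof.
move=> X0 z0.
pose F x := al * (\sum_i \sum_(j | j != i) avg (X i) (fun v => (sim v (x j))%:R))
            + al * (\sum_i \sum_(j | j != i) (sim (x i) (x j))%:R)
            + (be * crossdens X + \sum_i z i / #|X i|%:R).
have : pavg X F <= (2 * al + be) * crossdens X + \sum_i z i / #|X i|%:R.
  rewrite /F !pavgD !pavgZ !pavg_cst //.
  have -> : pavg X (fun x => \sum_i \sum_(j | j != i) avg (X i) (fun v => (sim v (x j))%:R)) = crossdens X.
    rewrite /crossdens pavg_sum; apply: eq_bigr => i _; rewrite pavg_sum; apply: eq_bigr => j _.
    by rewrite (pavg_proj1 j (fun u => avg (X i) (fun v => (sim v u)%:R))) // avgC.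
  have -> : pavg X (fun x => \sum_i \sum_(j | j != i) (sim (x i) (x j))%:R) = crossdens X.
    rewrite /crossdens pavg_sum; apply: eq_bigr => i _; rewrite pavg_sum; apply: eq_bigr => j ji.
    by rewrite (pavg_proj2 (fun u v => (sim u v)%:R)) // eq_sym.
  by lra.
case/(pavg_exists X0) => x xX Fx.
pose G y := al * (\sum_i (nadj i x (y i) + nadj i x (x i))%:R) + be * crossdens (cell X x y)
      + \sum_i z i * weight (pattern i x (y i)) / 8 / #|cell X x y i|%:R.
have nadjR i v : (nadj i x v)%:R = \sum_(j | j != i) (sim v (x j))%:R :> R by rewrite natr_sum.
have : pavg X G <= F x.
  have -> : pavg X G = al * (\sum_i \sum_(j | j != i) avg (X i) (fun v => (sim v (x j))%:R))
      + al * (\sum_i \sum_(j | j != i) (sim (x i) (x j))%:R) + be * crossdens X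
      + \sum_i pavg X (fun y => z i * weight (pattern i x (y i)) / 8 / #|cell X x y i|%:R).
    rewrite /G !pavgD !pavgZ crossdens_cell // !pavg_sum; congr (_ + _ + _).
    rewrite -mulrDr -big_split; congr (_ * _); apply: eq_bigr => i _ /=.
    under eq_pavg => y do rewrite natrD !nadjR.
    rewrite pavgD pavg_cst // (pavg_proj1 i (fun v => \sum_(j | j != i) (sim v (x j))%:R)) //.
    by rewrite avg_sum.
  rewrite /F -!addrA !lerD2l; apply: ler_sum => i _.
  have -> : pavg X (fun y => z i * weight (pattern i x (y i)) / 8 / #|cell X x y i|%:R) =
      pavg X (fun y => z i / 8 * (weight (pattern i x (y i)) / #|cell X x y i|%:R)).
    by apply: eq_pavg => y; rewrite [in RHS]mulrACA mulrA.
  rewrite pavgZ (pavg_proj1 i (fun v => weight (pattern i x v) / #|fibre (pattern i x) (X i) v|%:R)) //.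
  have := avg_inv_fibre (pattern i x) (X i) weight_ge0.
  have w8 := sum_weight.
  have c0 : 0 <= #|X i|%:R^-1 :> R by rewrite invr_ge0 ler0n.
  have /= := ler_wpM2r c0 w8.
  have := z0 i; set c := _^-1; set s := \sum_p _; set t := avg _ _.
  move=> z0i h1 h2; rewrite -mulrA; apply: ler_wpM2l => //; lra.
case/(pavg_exists X0) => y yX Gy; exists x, y; split => //.
exact: le_trans Gy Fx.
Qed.

Definition coherent w x x' := [forall i, pattern i x (x' i) == pattern i x (w i)].

Lemma process (al : R) T X (z : I -> R) :
    (forall i, X i != set0) -> (forall i, 0 <= z i) ->
  exists w Y (xs : seq {ffun I -> V}),
  [/\ size xs = T,
      forall i, w i \in Y i /\ Y i \subset X i,
      forall x, x \in xs -> forall i, x i \in X i,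
      pairwise (coherent w) xs &
      (forall x, x \in xs -> forall i v, v \in Y i -> pattern i x v = pattern i x (w i)) /\
      al * (\sum_(x <- xs) \sum_i (nadj i x (w i) + nadj i x (x i))%:R)
      + \sum_i z i * (8 ^- T * (2 * #|I|%:R) ^- (\sum_(x <- xs) nadj i x (w i))) / #|Y i|%:R
      <= 2 * T%:R * al * crossdens X + \sum_i z i / #|X i|%:R].
Proof.
elim: T X z => [|T IH] X z X0 z0.
  have /fin_all_exists[w wX] (i : I) : exists v, v \in X i by apply/set0Pn.
  exists [ffun i => w i], X, [::]; split => //; first by move=> i; rewrite ffunE.
  split => //; rewrite big_nil mulr0 add0r !mulr0 !mul0r add0r.
  by apply: ler_sum => i _; rewrite big_nil !expr0 !invr1 !mulr1.
(* The coefficient [2 * T%:R * al] of the new density is the price of the [T] rounds still to come;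
   [z'] below carries this round's weight into them. *)
have [x [y [xX yX le]]] := process_step al (2 * T%:R * al) X0 z0.
have C0 i : cell X x y i != set0 by apply/set0Pn; exists (y i); exact: fibre_self.
pose z' i := z i * weight (pattern i x (y i)) / 8.
have z'0 i : 0 <= z' i by rewrite !mulr_ge0 ?weight_ge0 // invr_ge0.
have [w [Y [xs [sz wY xsX pw [pY le']]]]] := IH (cell X x y) z' C0 z'0.
have YX i : Y i \subset X i.
  by apply: subset_trans (wY i).2 _; apply/subsetP => v; rewrite inE => /andP[].
have cellP i v : v \in cell X x y i -> pattern i x v = pattern i x (y i).
  by rewrite inE => /andP[_ /eqP].
have wcell i : w i \in cell X x y i by apply: (subsetP (wY i).2); exact: (wY i).1.
exists w, Y, (x :: xs); split => //=.
- by rewrite sz.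
- by move=> i; split; [exact: (wY i).1|].
- move=> x'; rewrite inE => /predU1P[-> //|/xsX h i].
  by have := h i; rewrite inE => /andP[].
- rewrite pw andbT; apply/allP => x' /xsX h; apply/forallP => i.
  by rewrite !cellP.
split=> [x'|].
  rewrite inE => /predU1P[->|/pY] // i v vY.
  by rewrite !cellP //; apply: (subsetP (wY i).2).
pose S := \sum_(x0 <- xs) \sum_i (nadj i x0 (w i) + nadj i x0 (x0 i))%:R : R.
pose S0 := \sum_i (nadj i x (y i) + nadj i x (x i))%:R : R.
have nadjE i : nadj i x (w i) = nadj i x (y i).
  have := cellP i _ (wcell i); rewrite /pattern => -[/ffunP e _ _].
  by apply: eq_bigr => j ji; have := e j; rewrite !ffunE ji /= => ->.
rewrite big_cons (_ : \sum_i (nadj i x (w i) + _)%:R = S0); last first.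
  by apply: eq_bigr => i _; rewrite nadjE.
rewrite (_ : \sum_i z i * _ / _ = \sum_i z' i *
  (8 ^- T * (2 * #|I|%:R) ^- (\sum_(x0 <- xs) nadj i x0 (w i))) / #|Y i|%:R); last first.
  apply: eq_bigr => i _; congr (_ / _); rewrite /z' weight_pattern big_cons exprD exprS nadjE !invfM.
  by ring.
by move: le le'; rewrite -/S -/S0 -natr1 /z'; lra.
Qed.
End Process.

(** * Large layered subsets *)

Definition layered (V : finType) (arc : rel V) (h : nat) (S : {set V}) : Prop :=
  exists lab : V -> nat, {in S, forall u, (lab u < h)%N} /\
    {in S &, forall u v, arc u v -> (lab u < lab v)%N}.

Definition narcs (V : finType) (arc : rel V) : nat := #|[set p : V * V | arc p.1 p.2]|.

Lemma narcsE (V : finType) (arc : rel V) : narcs arc = (\sum_u \sum_v arc u v)%N.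
Proof.
rewrite pair_big /= /narcs -sum1_card big_mkcond /=.
by apply: eq_bigr => p _; rewrite inE; case: (arc _ _).
Qed.

Lemma sum_sim_le (V : finType) (arc : rel V) (U : {set V}) :
  (\sum_(u in U) \sum_(v in U) sim arc u v <= #|U| + 2 * narcs arc)%N.
Proof.
apply: (@leq_trans (\sum_(u in U) \sum_(v in U) ((u == v) + (arc u v + arc v u)))%N).
  apply: leq_sum => u _; apply: leq_sum => v _; rewrite /sim.
  by case: (u == v); case: (arc u v); case: (arc v u).
under eq_bigr => u _ do rewrite !big_split /=.
rewrite !big_split /=; apply: leq_add.
  rewrite -sum1_card; apply: leq_sum => u uU; rewrite (bigD1 u) //= eqxx big1 //.
  by move=> v /andP[_]; rewrite eq_sym => /negPf ->.
rewrite mul2n -addnn; apply: leq_add; last rewrite exchange_big /=; rewrite narcsE.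
all: rewrite [X in (_ <= X)%N](bigID (mem U)) /=; apply: leq_trans (leq_addr _ _).
all: apply: leq_sum => u _; rewrite [X in (_ <= X)%N](bigID (mem U)) /=; exact: leq_addr.
Qed.

Lemma crossdens_const (R : realFieldType) (V I : finType) (arc : rel V) (U : {set V}) :
  crossdens R arc (fun _ : I => U) =
  #|I|%:R * (#|I|.-1)%:R * ((\sum_(u in U) \sum_(v in U) sim arc u v)%N%:R / #|U|%:R ^+ 2).
Proof.
have inner (c : R) (i : I) : \sum_(j | j != i) c = c *+ #|I|.-1.
  by rewrite -(cardC1 i) -sumr_const; apply: eq_bigl => j; rewrite inE.
rewrite /crossdens; set p := avg U _.
transitivity (\sum_(i : I) p *+ #|I|.-1); first by apply: eq_bigr => i _; exact: inner.
rewrite {}/p sumr_const -[_ *+ #|_|]mulr_natl -[_ *+ _.-1]mulr_natl mulrA; congr (_ * _).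
rewrite avgE natr_sum expr2 invfM mulrA; congr (_ / _).
by rewrite mulr_suml; apply: eq_bigr => u _; rewrite avgE natr_sum.
Qed.

Section LayeredSubset.
Variables (V : finType) (arc : rel V).
Hypothesis arc_irr : forall u, ~~ arc u u.
Hypothesis arc_asym : forall u v, ~~ (arc u v && arc v u).

Lemma sparse_process (R : realFieldType) (U : {set V}) (k T : nat) :
    (0 < k)%N -> (0 < T)%N ->
    (16 * k.-1 * (#|U| + 2 * narcs arc) <= #|U| ^ 2)%N ->
    ((16 * k) ^ T.+1 < #|U|)%N ->
  exists w (Y : 'I_k -> {set V}) (xs : seq {ffun 'I_k -> V}),
  [/\ size xs = T,
      forall x, x \in xs -> forall i, x i \in U,
      pairwise (coherent arc w) xs,
      forall x, x \in xs -> forall i v, v \in Y i -> pattern arc i x v = pattern arc i x (w i) &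
      (4 * \sum_(x <- xs) \sum_i (nadj arc i x (w i) + nadj arc i x (x i)) <= k * T)%N /\
      forall i, (\sum_(x <- xs) nadj arc i x (w i) <= T)%N -> (1 < #|Y i|)%N].
Proof.
move=> k0 T0 hk hn; set n := #|U| in hk hn *.
have n0 : (0 < n)%N by apply: leq_ltn_trans hn.
have U0 : U != set0 by rewrite -cards_eq0 -lt0n.
have nR0 : 0 < n%:R :> R by rewrite ltr0n.
have kR0 : 0 < k%:R :> R by rewrite ltr0n.
have TR0 : 0 < T%:R :> R by rewrite ltr0n.
(* With this [al] and 16 D <= k, the density term of [process] is at most k / n, as is the initial
   sum of inverse sizes; everything is bounded by 2k / n. *)
pose al : R := 8 / (n%:R * T%:R).
have [w [Y [xs [sz wY xsU pw [pY le]]]]] :=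
  @process R V 'I_k arc al T (fun=> U) (fun=> 1) (fun=> U0) (fun=> ler01).
exists w, Y, xs; split => //.
have D_le : 16 * crossdens R arc (fun _ : 'I_k => U) <= k%:R.
  rewrite crossdens_const card_ord -/n.
  rewrite mulrCA -mulrA -[leRHS]mulr1; apply: ler_wpM2l; first exact: ltW.
  rewrite mulrCA !mulrA ler_pdivrMr ?exprn_gt0 // mul1r.
  rewrite -!natrM -natrX ler_nat; apply: leq_trans hk; rewrite leq_mul2l.
  by apply/orP; right; exact: sum_sim_le.
set S := \sum_(x <- xs) _ in le.
have SE : S = (\sum_(x <- xs) \sum_i (nadj arc i x (w i) + nadj arc i x (x i)))%N%:R.
  by rewrite natr_sum; apply: eq_bigr => x _; rewrite natr_sum.
move: le; rewrite SE; set s := (\sum_(x <- xs) _)%N.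
have -> : \sum_(i < k) 1 / #|U|%:R = k%:R / n%:R :> R.
  by rewrite sumr_const card_ord div1r mulr_natl.
set D := crossdens _ _ _ in D_le *; rewrite card_ord; set Z := \sum_i _ => le.
have Zi0 i : 0 <= 1 * (8 ^- T * (2 * k%:R) ^- (\sum_(x <- xs) nadj arc i x (w i))) / #|Y i|%:R :> R.
  by rewrite !mulr_ge0 ?invr_ge0 ?exprn_ge0 ?ler0n // mulr_ge0.
have {}le : al * s%:R + Z <= 2 * k%:R / n%:R.
  apply: le_trans le _.
  have -> : 2 * T%:R * al * D = 16 * D / n%:R.
    by rewrite /al; field; rewrite !gt_eqF.
  have := ler_wpM2r (ltW (_ : 0 < n%:R^-1)) D_le; rewrite invr_gt0 => /(_ nR0); lra.
have Z0 : 0 <= Z by apply: sumr_ge0.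
have al0 : 0 < al by rewrite divr_gt0 // mulr_gt0.
split.
  have {}le : al * s%:R <= 2 * k%:R / n%:R by lra.
  rewrite -(ler_nat R) !natrM.
  have := ler_wpM2r (ltW (mulr_gt0 nR0 TR0)) le.
  have -> : al * s%:R * (n%:R * T%:R) = 8 * s%:R by rewrite /al; field; rewrite !gt_eqF.
  have -> : 2 * k%:R / n%:R * (n%:R * T%:R) = 2 * k%:R * T%:R :> R by field; rewrite !gt_eqF.
  by lra.
move=> i Ai; rewrite ltnNge; apply/negP => Y1.
have {}Y1 : #|Y i| = 1%N.
  by apply/eqP; rewrite eqn_leq Y1; apply/card_gt0P; exists (w i); exact: (wY i).1.
(* A one-point cluster with at most [T] adjacencies would alone contribute at least (16k)^(-T) to
   [Z], which exceeds 2k / n by the lower bound on [#|U|]. *)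
have : 8 ^- T * (2 * k%:R) ^- (\sum_(x <- xs) nadj arc i x (w i)) <= 2 * k%:R / n%:R :> R.
  apply: le_trans (_ : Z <= _); last by have := mulr_ge0 (ltW al0) (ler0n R s); lra.
  rewrite /Z (bigD1 i) //= Y1 mul1r divr1 lerDl.
  by apply: sumr_ge0 => j _.
apply/negP; rewrite -ltNge.
apply: lt_le_trans (_ : (8 ^- T * (2 * k%:R) ^- T <= _)); last first.
  rewrite ler_wpM2l ?invr_ge0 ?exprn_ge0 // lef_pV2 ?posrE ?exprn_gt0 ?mulr_gt0 //.
  by rewrite ler_weXn2l // -natrM ler1n muln_gt0.
rewrite -invfM -exprMn ltr_pdivrMr // ltr_pdivlMl; last by rewrite exprn_gt0 // -!natrM ltr0n !muln_gt0.
rewrite -!natrM -natrX -natrM ltr_nat.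
apply: leq_ltn_trans hn; rewrite expnSr.
by apply: leq_mul; rewrite ?mulnA // leq_mul2r orbT.
Qed.

Lemma layered_subset (R : realFieldType) (U : {set V}) (k T : nat) :
    (0 < k)%N -> (0 < T)%N ->
    (16 * k.-1 * (#|U| + 2 * narcs arc) <= #|U| ^ 2)%N ->
    ((16 * k) ^ T.+1 < #|U|)%N ->
  exists S : {set V}, [/\ S \subset U, (k * T <= 2 * #|S|)%N & layered arc (2 * T) S].
Proof.
move=> k0 T0 hk hn.
have [w [Y [xs [sz xsU pw pY [hS hY]]]]] := sparse_process R k0 T0 hk hn.
pose A i := (\sum_(x <- xs) nadj arc i x (w i))%N.
pose B (i : 'I_k) := (\sum_(x <- xs) nadj arc i x (x i))%N.
have {}hS : (4 * (\sum_i A i + \sum_i B i) <= k * T)%N.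
  rewrite /A /B exchange_big /= [X in (_ + X)%N]exchange_big /= -big_split /=.
  by under eq_bigr => x _ do rewrite -big_split.
pose X (t : 'I_T) := nth w xs t.
have sum_xs (F : {ffun 'I_k -> V} -> nat) : (\sum_(x <- xs) F x = \sum_t F (X t))%N.
  by rewrite (big_nth w) big_mkord sz.
have X_in t : X t \in xs by rewrite mem_nth // sz.
have X_coh (t t' : 'I_T) : (t < t')%N -> forall i, pattern arc i (X t) (X t' i) = pattern arc i (X t) (w i).
  move=> tt' i; move/(pairwiseP w): pw => /(_ t t'); rewrite !inE sz !ltn_ord => /(_ isT isT tt').
  by move/forallP/(_ i)/eqP.
have patP (x : {ffun 'I_k -> V}) i u v : pattern arc i x u = pattern arc i x v ->
    [/\ forall j, j != i -> sim arc u (x j) = sim arc v (x j),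
       (u == x i) = (v == x i) & arc u (x i) = arc v (x i)].
  move=> -[/ffunP e e1 e2]; split => // j ji; have := e j; by rewrite !ffunE ji.
pose bad i := (T < A i)%N.
(* [X t j] is kept if cluster j is large at the end and [X t j] is not adjacent to
   the representative or to the round-t pivot of any other cluster.  By coherence,
   later pivots of those clusters are then not adjacent to it either. *)
pose keep (p : 'I_T * 'I_k) := [&& ~~ bad p.2,
   [forall i, (i != p.2) ==> ~~ sim arc (w i) (X p.1 p.2)] &
   [forall i, (i != p.2) ==> ~~ sim arc (X p.1 i) (X p.1 p.2)]].
(* Each bad cluster loses its [T] pivots but has more than [T] adjacencies, so these losses are at
   most the sum of the [A i]; all other losses are counted by [A] and [B]. *)
have cnt : (2 * \sum_p ~~ keep p <= k * T)%N.
  apply: (@leq_trans (2 * \sum_(p : 'I_T * 'I_k) (bad p.2 +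
     (\sum_(i | i != p.2) sim arc (w i) (X p.1 p.2) + nadj arc p.2 (X p.1) (X p.1 p.2))))%N).
    rewrite leq_mul2l /=; apply: leq_sum => -[t j] _; rewrite /keep /=.
    case: (bad j) => //=; rewrite add0n negb_and !negb_forall.
    case: existsP => [[i]|_] /=.
      by rewrite negb_imply negbK => /andP[ij s]; rewrite (bigD1 i) //= s.
    case: existsP => //= -[i]; rewrite negb_imply negbK => /andP[ij s].
    by rewrite /nadj [X in (_ <= _ + X)%N](bigD1 i) //= sim_sym s addnC.
  rewrite -(pair_bigA _ (fun t j => bad j +
    (\sum_(i | i != j) sim arc (w i) (X t j) + nadj arc j (X t) (X t j))))%N /=.
  have -> : (\sum_t \sum_j (bad j + (\sum_(i | i != j) sim arc (w i) (X t j) + nadj arc j (X t) (X t j))) =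
     T * \sum_j bad j + (\sum_i A i + \sum_i B i))%N.
    under eq_bigr => t _ do rewrite !big_split /=.
    rewrite !big_split /= sum_nat_const card_ord; congr (_ + (_ + _))%N.
      rewrite /A [RHS]exchange_big sum_xs; apply: eq_bigr => t _.
      rewrite /nadj (exchange_big_dep xpredT) //=; apply: eq_bigr => i _; apply: eq_bigl => j.
      by rewrite eq_sym.
    by rewrite /B [RHS]exchange_big sum_xs.
  suff : (4 * (T * \sum_j bad j) <= 4 * \sum_i A i)%N by lia.
  rewrite leq_mul2l /= big_distrr /=; apply: leq_sum => i _; rewrite /bad.
  by case: ltnP; lia.
pose f (p : 'I_T * 'I_k) : V := X p.1 p.2.
(* If [w] were the pivot itself, the equality bit of the pattern would force the whole final cluster
   to be that single point. *)
have neq_w p : keep p -> w p.2 != f p.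
  case: p => t j /and3P[/= nb _ _]; apply/negP => /eqP; rewrite /f /= => e.
  have : (1 < #|Y j|)%N by apply: hY; rewrite leqNgt.
  rewrite ltnNge => /negP; apply; rewrite -(cards1 (w j)); apply/subset_leq_card/subsetP => v vY.
  have [_ + _] := patP _ _ _ _ (pY _ (X_in t) j v vY).
  by rewrite -e eqxx inE => ->.
have nsim p p' : keep p -> keep p' -> p.2 != p'.2 -> ~~ sim arc (f p) (f p').
  have aux (t t' : 'I_T) (i j : 'I_k) : keep (t, i) -> i != j -> (t < t')%N -> ~~ sim arc (X t i) (X t' j).
    move=> /and3P[_ /forallP h _] ij tt'; rewrite sim_sym.
    have [-> // _ _] := patP _ _ _ _ (X_coh _ _ tt' j).
    by have /implyP := h j; rewrite eq_sym; apply.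
  case: p p' => [t i] [t' j] ki kj /= ij; case: (ltngtP t t') => [tt'|tt'|/val_inj e].
  - exact: aux.
  - by rewrite sim_sym; apply: aux => //; rewrite eq_sym.
  - subst t'; case/and3P: kj => _ _ /forallP /(_ i) /implyP; exact.
have same (p p' : 'I_T * 'I_k) : keep p -> p.2 = p'.2 -> (p.1 < p'.1)%N ->
    (f p' != f p) /\ arc (f p') (f p) = arc (w p.2) (f p).
  case: p p' => [t i] [t' j] kp /= <- tt'.
  by have [_ -> ->] := patP _ _ _ _ (X_coh _ _ tt' i); split => //; exact: (neq_w (t, i)).
have f_inj : {in keep &, injective f}.
  move=> p p' kp kp' e; case: (eqVneq p.2 p'.2) => [e2|/nsim]; last first.
    by move=> /(_ kp kp'); rewrite /sim e eqxx.
  case: (ltngtP p.1 p'.1) => [l|l|/val_inj e1].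
  - by have [] := same _ _ kp e2 l; rewrite e eqxx.
  - by have [] := same _ _ kp' (esym e2) l; rewrite e eqxx.
  - by case: p p' e1 e2 {kp kp' e} => [? ?] [? ?] /= -> ->.
(* All later pivots of the cluster lie on the same side of [X t j] as [w j]. *)
pose L (p : 'I_T * 'I_k) : nat := if arc (w p.2) (f p) then (2 * T - 1 - p.1)%N else p.1.
have L_lt p : (L p < 2 * T)%N.
  by rewrite /L; have := ltn_ord p.1; case: ifP; lia.
(* Labels below [T] follow the order of rounds, labels from [T] on reverse it. So a pivot with an
   arc from [w] lies above all later pivots of its cluster, and any other pivot lies below them. *)
have L_mono p p' : keep p -> keep p' -> arc (f p) (f p') -> (L p < L p')%N.
  move=> kp kp' a; case: (eqVneq p.2 p'.2) => [e2|/nsim]; last first.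
    by move=> /(_ kp kp'); rewrite /sim a orbT.
  have := ltn_ord p.1; have := ltn_ord p'.1; case: (ltngtP p.1 p'.1) => [l|l|/val_inj e1].
  - have [_ e] := same _ _ kp e2 l; rewrite /L -e.
    have := arc_asym (f p) (f p'); rewrite a /= => /negPf ->.
    by case: ifP; lia.
  - have [_ e] := same _ _ kp' (esym e2) l; rewrite /L -e a.
    by case: ifP; lia.
  - have := arc_irr (f p); rewrite {2}(_ : p = p') ?a //.
    by case: p p' e1 e2 {kp kp' a} => [? ?] [? ?] /= -> ->.
exists (f @: [set p | keep p]); split.
- by apply/subsetP => _ /imsetP[p _ ->]; exact: xsU.
- rewrite card_in_imset => [|p p']; last by rewrite !inE; exact: f_inj.
  have : (\sum_p keep p + \sum_p ~~ keep p = k * T)%N.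
    rewrite -big_split /= mulnC -[k in RHS]card_ord -[T in RHS]card_ord -card_prod -sum1_card.
    by apply: eq_bigr => p _; case: (keep p).
  have -> : #|[set p | keep p]| = (\sum_p keep p)%N.
    by rewrite -sum1_card big_mkcond; apply: eq_bigr => p _; rewrite inE; case: (keep p).
  by lia.
exists (fun v => if [pick p | keep p && (f p == v)] is Some p then L p else 0%N).
have labE p : keep p -> (if [pick p' | keep p' && (f p' == f p)] is Some p' then L p' else 0%N) = L p.
  move=> kp; case: pickP => [p' /andP[kp' /eqP e]|/(_ p)]; last by rewrite kp eqxx.
  by congr L; apply: f_inj.
split.
  by move=> _ /imsetP[p + ->]; rewrite inE => kp; rewrite labE.
move=> _ _ /imsetP[p + ->] /imsetP[p' + ->]; rewrite !inE => kp kp' a.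
by rewrite !labE //; exact: L_mono.
Qed.
End LayeredSubset.

(** * Covering all vertices by layered sets *)

Section Covering.
Variables (V : finType) (arc : rel V).
Hypothesis arc_irr : forall u, ~~ arc u u.
Hypothesis arc_asym : forall u v, ~~ (arc u v && arc v u).
Implicit Types U : {set V}.

Definition covered (h M : nat) (U : {set V}) : Prop :=
  exists g lab : V -> nat,
    {in U, forall u, (g u < M)%N /\ (lab u < h)%N} /\
    {in U &, forall u v, arc u v -> g u = g v -> (lab u < lab v)%N}.

Lemma covered_layered h S : layered arc h S -> covered h 1 S.
Proof.
case=> lab [lt mono]; exists (fun=> 0%N), lab.
by split => [u /lt|u v uS vS a _] //; exact: mono.
Qed.

Lemma coveredU h M1 M2 U1 U2 :
  covered h M1 U1 -> covered h M2 U2 -> covered h (M1 + M2) (U1 :|: U2).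
Proof.
case=> g1 [l1 [b1 m1]] [g2 [l2 [b2 m2]]].
exists (fun u => if u \in U1 then g1 u else M1 + g2 u)%N.
exists (fun u => if u \in U1 then l1 u else l2 u); split=> [u|u v]; rewrite !inE.
  case: ifP => [/b1[gu lu] _|_ /= /b2[gu lu]]; split => //; lia.
case: ifP => [u1 _|_ /= u2]; case: ifP => [v1 _|_ /= v2] // a.
- exact: m1.
- by have [] := b1 _ u1; lia.
- by have [] := b1 _ v1; lia.
- by move/addnI; exact: m2.
Qed.

Lemma covered_singletons h U : (0 < h)%N -> covered h #|U| U.
Proof.
move=> h0; exists (fun u => index u (enum U)), (fun=> 0%N); split=> [u uU|u v uU vU a e].
  by rewrite cardE index_mem mem_enum.
have {}e : u = v by move/index_inj: e => /(_ u); rewrite !mem_enum; exact.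
move: a; rewrite e.
by move/negP: (arc_irr v).
Qed.

Definition deg (u : V) : nat := #|[set v | arc u v || arc v u]|.

(** A greedy proper colouring: its classes are independent sets, for which a single layer
    suffices. *)
Lemma covered_greedy h d U : (0 < h)%N -> {in U, forall u, (deg u < d)%N} -> covered h d U.
Proof.
move=> h0; move: {2}#|U| (leqnn #|U|) => n; elim: n U => [|n IH] U.
  rewrite leqn0 cards_eq0 => /eqP -> _; exists (fun=> 0%N), (fun=> 0%N).
  by split=> [u|u v]; rewrite inE.
have [->|[u uU]] := set_0Vmem U.
  by move=> _; apply: IH; rewrite cards0.
rewrite (cardsD1 u) uU ltnS => /IH IHU degU.
have /IHU[g [lab [b m]]] : {in U :\ u, forall v, (deg v < d)%N}.
  by move=> v; rewrite inE => /andP[_]; exact: degU.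
have [c cd cP] : exists2 c, (c < d)%N & forall v, arc u v || arc v u -> g v <> c.
  pose F := [set i : 'I_d | [exists v, (arc u v || arc v u) && (g v == i)]].
  have ltF : (#|F| < d)%N.
    apply: leq_ltn_trans (degU _ uU).
    (* Colours out of range, possible outside [U], are sent to 0; this is harmless, as only colours
       in [F] must be reached. *)
    pose e v : 'I_d := insubd (Ordinal (leq_ltn_trans (leq0n _) (degU _ uU))) (g v).
    apply: leq_trans (leq_imset_card e _); apply: subset_leq_card.
    apply/subsetP => i; rewrite inE => /existsP[v /andP[a /eqP gv]].
    by apply/imsetP; exists v; rewrite ?inE //; apply: val_inj; rewrite val_insubd gv ltn_ord.
  have [e|[i]] := set_0Vmem (~: F).
    by have := cardsC F; rewrite e cards0 card_ord => e'; lia.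
  rewrite !inE => /existsPn no; exists i => // v a gv.
  by have := no v; rewrite a gv eqxx.
exists (fun v => if v == u then c else g v), (fun v => if v == u then 0%N else lab v).
split=> [v vU|v v' vU v'U].
  by case: eqP => // /eqP vu; apply: b; rewrite !inE vu.
case: eqP => [->|/eqP vu]; case: eqP => [->|/eqP vu'] a.
- by have := arc_irr u; rewrite a.
- by move=> e; case: (cP v'); rewrite ?a.
- by move=> e; case: (cP v); rewrite ?a ?orbT.
- by apply: m; rewrite ?inE ?vu ?vu'.
Qed.

Lemma sum_deg : (\sum_u deg u <= 2 * narcs arc)%N.
Proof.
rewrite narcsE mul2n -addnn [X in (_ <= _ + X)%N]exchange_big -big_split /=.
apply: leq_sum => u _; rewrite -big_split /= /deg -sum1_card big_mkcond /=.
by apply: leq_sum => v _; rewrite inE; case: (arc u v); case: (arc v u).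
Qed.

(* The potential x / (x + N) drops by at least a constant times T / N in each
   extraction, both for x >= N and for x <= N. *)
Lemma covered_dense (R : realFieldType) (N T : nat) U :
    (0 < T)%N -> (T * (16 * T ^ 2) ^ T.+1 < N)%N -> (narcs arc <= N ^ 2)%N ->
    (#|U| <= 2 * N * T)%N ->
  exists2 M, covered (2 * T) M U &
    M%:R <= N%:R / T%:R * (1 + 768 * (#|U|%:R / (#|U|%:R + N%:R))) :> R.
Proof.
move=> T0 hN hm; move: {2}#|U| (leqnn #|U|) => n; elim: n U => [|n IH] U.
  rewrite leqn0 cards_eq0 => /eqP -> _; exists 0%N; last first.
    by rewrite cards0 mul0r mulr0 addr0 mulr1 divr_ge0.
  by exists (fun=> 0%N), (fun=> 0%N); split=> [u|u v]; rewrite inE.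
move=> Un UNT; set x := #|U| in Un UNT *.
have N2T : (16 * T <= N)%N.
  apply: leq_trans (ltnW hN); rewrite mulnC leq_mul2l expnS; apply/orP; right.
  by rewrite -mulnA leq_pmulr // muln_gt0 !expn_gt0 muln_gt0 expn_gt0 T0.
have N0 : 0 < N%:R :> R by rewrite ltr0n; lia.
have TR0 : 0 < T%:R :> R by rewrite ltr0n.
have [xN|Nx] := leqP (x * T) N.
  exists x; first by apply: covered_singletons; lia.
  have : x%:R <= N%:R / T%:R :> R by rewrite ler_pdivlMr // -natrM ler_nat.
  move/le_trans; apply; rewrite ler_peMr ?divr_ge0 //.
  by rewrite lerDl mulr_ge0 // divr_ge0 // addr_ge0.
(* The constant 48 = 16 * 3 matches x + 2 [narcs arc] <= 3 N^2, which makes the density condition of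
   [layered_subset] hold. *)
pose f := (x ^ 2 %/ (48 * N ^ 2))%N; pose k := maxn 1 f.
have N48 : (0 < 48 * N ^ 2)%N by rewrite muln_gt0 expn_gt0; lia.
have fx : (48 * N ^ 2 * f <= x ^ 2)%N by rewrite mulnC; exact: leq_divM.
have xf : (x ^ 2 < 48 * N ^ 2 * f.+1)%N by rewrite mulnC; exact: ltn_ceil.
have kT2 : (k <= T ^ 2)%N.
  rewrite geq_max expn_gt0 T0 /= -(leq_pmul2l N48); apply: leq_trans fx _.
  apply: (@leq_trans ((2 * N * T) ^ 2)); first by rewrite leq_exp2r.
  by rewrite !expnMn; nia.
have k0 : (0 < k)%N by rewrite leq_max.
have hk : (16 * k.-1 * (#|U| + 2 * narcs arc) <= #|U| ^ 2)%N.
  rewrite -/x; have xN2 : (x + 2 * narcs arc <= 3 * N ^ 2)%N.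
    have : (2 * N * T <= N ^ 2)%N by rewrite expnS expn1; nia.
    by move: hm UNT; lia.
  have kf : (k.-1 <= f)%N by rewrite /k; lia.
  apply: leq_trans fx; apply: (@leq_trans (16 * f * (3 * N ^ 2))).
    by apply: leq_mul => //; rewrite leq_mul2l.
  by lia.
(* Since k <= T^2, the assumption on [N] gives T (16k)^(T+1) < N, and N < xT in the present case. *)
have hx : ((16 * k) ^ T.+1 < #|U|)%N.
  rewrite -(ltn_pmul2l T0) mulnC -/x; apply: leq_ltn_trans (_ : (T * (16 * T ^ 2) ^ T.+1 < _))%N.
    by rewrite mulnC leq_mul2l leq_exp2r // leq_mul2l kT2 !orbT.
  by apply: ltn_trans hN _; rewrite mulnC.
have [S [SU kS lS]] := layered_subset arc_irr arc_asym R k0 T0 hk hx.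
have S0 : (0 < #|S|)%N by nia.
have cU : (#|U :\: S| + #|S| = x)%N.
  by rewrite /x -(cardsID S U) addnC (setIidPr SU).
have [|| M' cM' leM'] := IH (U :\: S); first by lia.
  by lia.
exists (1 + M')%N.
  have -> : U = S :|: (U :\: S) by rewrite setDE setUIr setUCr setIT; apply/esym/setUidPr.
  by apply: coveredU => //; exact: covered_layered.
move: leM' cU; set x' := #|_ :\: _|; set E := #|S| in kS S0 * => leM' cU.
rewrite natrD; apply: le_trans (lerD (lexx _) leM') _.
have key : (T * (x + N) ^ 2 <= 768 * N ^ 2 * E)%N.
  have k1 : (x ^ 2 <= 96 * N ^ 2 * k)%N.
    apply: leq_trans (ltnW xf) _.
    have -> : (96 * N ^ 2 * k = 48 * N ^ 2 * (2 * k))%N by lia.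
    by rewrite leq_mul2l; apply/orP; right; rewrite /k; lia.
  have k2 : ((x + N) ^ 2 <= 384 * N ^ 2 * k)%N.
    have h : (N ^ 2 <= N ^ 2 * k)%N by rewrite leq_pmulr.
    rewrite sqrnD; move: (nat_Cauchy x N).1 k1 h; rewrite -!mulnA.
    by move: (x * N)%N (x ^ 2)%N (N ^ 2)%N (N * (N * k))%N => *; lia.
  apply: (@leq_trans (T * (384 * N ^ 2 * k))); first by rewrite leq_mul2l k2 orbT.
  have : (N ^ 2 * (k * T) <= N ^ 2 * (2 * E))%N by rewrite leq_mul2l kS orbT.
  by lia.
have {}key : T%:R * (x%:R + N%:R) ^+ 2 <= 768 * N%:R ^+ 2 * E%:R :> R.
  by rewrite -natrD -!natrX -!natrM ler_nat.
have cR : x%:R = x'%:R + E%:R :> R by rewrite -natrD cU.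
have x'0 : 0 <= x'%:R :> R by exact: ler0n.
have E0 : 0 <= E%:R :> R by exact: ler0n.
(* The right-hand side is the drop of the potential, as [e] shows below; a drop of at least 1 pays
   for the one new set. *)
have step : 1 <= N%:R / T%:R * 768 * (N%:R * E%:R / ((x%:R + N%:R) * (x'%:R + N%:R))) :> R.
  have d0 : 0 < (x%:R + N%:R) * (x'%:R + N%:R) :> R by apply: mulr_gt0; lra.
  rewrite mulrA ler_pdivlMr // mul1r -(ler_pM2l TR0).
  have -> : T%:R * (N%:R / T%:R * 768 * (N%:R * E%:R)) = 768 * N%:R ^+ 2 * E%:R :> R.
    by field; rewrite gt_eqF.
  apply: le_trans key; apply: ler_wpM2l; first exact: ltW.
  by rewrite expr2; apply: ler_wpM2l; lra.
have e : N%:R / T%:R * 768 * (N%:R * E%:R / ((x%:R + N%:R) * (x'%:R + N%:R))) =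
   N%:R / T%:R * 768 * (x%:R / (x%:R + N%:R)) - N%:R / T%:R * 768 * (x'%:R / (x'%:R + N%:R)) :> R.
  rewrite cR; field; rewrite !gt_eqF //; lra.
move: step; rewrite e; lra.
Qed.

(** Counting degrees leaves at most 2NT vertices in [H]. After multiplication by [T],
    [covered_dense] costs 769 N on [H], and the greedy colouring of the rest costs at most N + T <=
    2N. *)
Lemma covered_setT (R : realFieldType) (N T : nat) :
    (0 < T)%N -> (T * (16 * T ^ 2) ^ T.+1 < N)%N -> (narcs arc <= N ^ 2)%N ->
  exists2 M, covered (2 * T) M setT & (T * M <= 771 * N)%N.
Proof.
move=> T0 hN hm.
pose H := [set u | (N <= deg u * T)%N].
have N0 : (0 < N)%N by lia.
have TN : (T <= N)%N.
  by apply: leq_trans (ltnW hN); rewrite leq_pmulr // expn_gt0; lia.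
have cH : (#|H| <= 2 * N * T)%N.
  rewrite -(leq_pmul2r N0) -sum_nat_const.
  apply: (@leq_trans (\sum_(u in H) deg u * T)%N).
    by apply: leq_sum => u; rewrite inE.
  apply: (@leq_trans (T * (2 * narcs arc))%N); last first.
    by have := leq_mul (leqnn (2 * T)) hm; rewrite expnS expn1; lia.
  rewrite -big_distrl /= mulnC leq_mul2l; apply/orP; right.
  apply: leq_trans sum_deg; rewrite [X in (_ <= X)%N](bigID (mem H)) /=; exact: leq_addr.
have [M cM leM] := covered_dense R T0 hN hm cH.
exists (M + (N %/ T).+1)%N.
  rewrite -(setUCr H); apply: coveredU => //; apply: covered_greedy; first by lia.
  move=> u; rewrite !inE -ltnNge => h; rewrite ltnS.
  by rewrite leq_divRL // ltnW.
have {}leM : (T * M <= 769 * N)%N.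
  rewrite -(ler_nat R) !natrM mulrC -ler_pdivlMr ?ltr0n //.
  apply: le_trans leM _; rewrite mulrAC; apply: ler_wpM2r; first by rewrite invr_ge0.
  rewrite mulrC; apply: ler_wpM2r => //.
  have : #|H|%:R / (#|H|%:R + N%:R) <= 1 :> R.
    by rewrite ler_pdivrMr ?mul1r ?lerDl // ltr_wpDl ?ltr0n.
  by lra.
have := leq_divM N T; rewrite mulnDr mulnS; lia.
Qed.

End Covering.

(** * Edge colourings from coverings *)

Local Open Scope nat_scope.

Definition digit (b e x : nat) : nat := (x %/ b ^ e) %% b.

Lemma digit_lt b e x : 0 < b -> digit b e x < b.
Proof. exact: ltn_pmod. Qed.

Lemma digitS b e x : digit b e.+1 x = digit b e (x %/ b).
Proof. by rewrite /digit expnS divnMA. Qed.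

Lemma leq_digits b j x y : 0 < b -> x < b ^ j -> y < b ^ j ->
  (forall e, e < j -> digit b e y <= digit b e x) -> y <= x.
Proof.
move=> b0; elim: j x y => [|j IH] x y; first by rewrite expn0 !ltnS !leqn0 => /eqP -> /eqP ->.
rewrite expnS mulnC => xb yb le.
have := le 0 isT; rewrite /digit expn0 !divn1 => le0.
rewrite (divn_eq x b) (divn_eq y b); apply: leq_add => //; rewrite leq_mul2r; apply/orP; right.
apply: IH; rewrite ?ltn_divLR // => e ej; rewrite -!digitS; exact: le.
Qed.

Lemma digit_ltn b j x y : 0 < b -> x < y -> y < b ^ j ->
  exists2 e, e < j & digit b e x < digit b e y.
Proof.
move=> b0 xy yb; have xb := ltn_trans xy yb.
case: (boolP [exists e : 'I_j, digit b e x < digit b e y]) => [/existsP[e]|/existsPn no].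
  by exists e.
move: xy; rewrite ltnNge (leq_digits b0 xb yb) // => e ej.
by have := no (Ordinal ej); rewrite -leqNgt.
Qed.

Section Colouring.
Variables (V : finType) (arc : rel V).

(** Each colour has a potential increasing along its arcs, which bounds its paths. It is
    lexicographic: a number below [q * k] from the index of the set, then a base-[t] digit of the
    label, so all q + 1 colours serve inside a set. *)
Lemma colouring_of_cover (q k t M : nat) :
    0 < q -> 0 < k -> 0 < t -> covered arc (t ^ q.+1) M setT -> M <= k ^ q ->
  exists (c : V -> V -> 'I_q.+1) (phi : 'I_q.+1 -> V -> nat),
    (forall e u, phi e u < q * k * t) /\
    (forall u v, arc u v -> phi (c u v) u < phi (c u v) v).
Proof.
move=> q0 k0 t0 [g [lab [b m]]] Mk.
have gk u : g u < k ^ q by apply: leq_trans Mk; have [] := b u (in_setT _).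
have lt u : lab u < t ^ q.+1 by have [] := b u (in_setT _).
pose a e u := digit k e (g u); pose i e u := digit t e (lab u).
have ak e u : a e u < k by exact: digit_lt.
have it e u : i e u < t by exact: digit_lt.
pose A u := \sum_(e < q) (k.-1 - a e u).
(* Arcs between different sets for which no digit of the index increases have some
   digit decreasing; hence the complementary digit sum [A] for the last colour. *)
pose phi (e : 'I_q.+1) u := (if e < q then a e u else A u) * t + i e u.
have pick_c u v : arc u v -> exists e, phi e u < phi e v.
  move=> uv; case: (boolP [exists e : 'I_q, a e u < a e v]) => [/existsP[e lt_e]|/existsPn no].
    exists (widen_ord (leqnSn q) e); rewrite /phi /= ltn_ord.
    apply: (@leq_trans ((a e u).+1 * t)); first by rewrite mulSn addnC ltn_add2r.
    by apply: (@leq_trans (a e v * t)); rewrite ?leq_addr // leq_mul2r lt_e orbT.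
  have le e : e < q -> a e v <= a e u by move=> eq; have := no (Ordinal eq); rewrite -leqNgt.
  have [guv|guv] := eqVneq (g u) (g v).
    have luv := m u v (in_setT _) (in_setT _) uv guv.
    have [e eq lt_e] := digit_ltn t0 luv (lt v).
    exists (Ordinal eq); rewrite /phi /= /A /a guv ltn_add2l; exact: lt_e.
  exists ord_max; rewrite /phi /= ltnn.
  suff lt_A : A u < A v.
    apply: (@leq_trans ((A u).+1 * t)); first by rewrite mulSn addnC ltn_add2r.
    by apply: (@leq_trans (A v * t)); rewrite ?leq_addr // leq_mul2r lt_A orbT.
  have gvu : g v < g u.
    by rewrite ltn_neqAle eq_sym guv; exact: (leq_digits k0 (gk u) (gk v) le).
  have [e eq lt_e] := digit_ltn k0 gvu (gk u).
  rewrite /A (bigD1 (Ordinal eq)) //= [X in _ < X](bigD1 (Ordinal eq)) //= -addSn.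
  apply: leq_add; first by have := ak e u; rewrite /a; lia.
  by apply: leq_sum => f _; have := le f (ltn_ord f); lia.
exists (fun u v => if [pick e | phi e u < phi e v] is Some e then e else ord0), phi; split.
  move=> e u; apply: (@leq_trans ((if e < q then a e u else A u).+1 * t)).
    by rewrite /phi mulSn addnC ltn_add2r.
  rewrite leq_mul2r; apply/orP; right; case: ifP => _.
    by apply: leq_trans (ak e u) _; rewrite leq_pmull.
  have : A u <= \sum_(e < q) k.-1 by apply: leq_sum => f _; exact: leq_subr.
  rewrite sum_nat_const card_ord; nia.
move=> u v uv; case: pickP => // no; have [e] := pick_c u v uv; by rewrite no.
Qed.

End Colouring.

(** * Monochromatic paths in transitive tournaments *)

Fixpoint mono_end (N : nat) (K : eqType) (c : 'I_N -> 'I_N -> K) (e : K) (j : nat) (v : 'I_N) : bool :=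
  if j is j'.+1 then [exists u : 'I_N, [&& u < v, c u v == e & mono_end c e j' u]] else true.

Lemma mono_endW N (K : eqType) (c : 'I_N -> 'I_N -> K) e j v :
  mono_end c e j.+1 v -> mono_end c e j v.
Proof.
elim: j v => [//|j IH] v /existsP[u /and3P[uv cuv /IH h]].
by apply/existsP; exists u; rewrite uv cuv.
Qed.

Lemma mono_end_path N (K : eqType) (c : 'I_N -> 'I_N -> K) e j v : mono_end c e j v ->
  exists f : nat -> 'I_N, f j = v /\
    forall i, i < j -> f i < f i.+1 /\ c (f i) (f i.+1) = e.
Proof.
elim: j v => [|j IH] v /=; first by exists (fun=> v).
case/existsP => u /and3P[uv /eqP cuv /IH[f [fj fP]]].
exists (fun i => if i <= j then f i else v); split=> [|i]; first by rewrite ltnn.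
move=> ij /=; have [ji|ij'|->] := ltngtP i j; first 1 last.
- by move: ij; rewrite ltnS leqNgt ij'.
- by rewrite fj.
exact: fP.
Qed.

(** Erdos-Szekeres argument: the vectors of longest path lengths in each colour, capped below [n],
    take at most n^r values, yet they differ at any two vertices in the colour of their arc. *)
Lemma tournament_mono_path (n r : nat) (c : 'I_(n ^ r).+1 -> 'I_(n ^ r).+1 -> 'I_r) : 0 < n ->
  exists e v, mono_end c e n.-1 v.
Proof.
move=> n0; pose L e v := \max_(j < n | mono_end c e j v) j.
have L_lt e v : L e v < n.
  by rewrite /L; elim/big_ind: _ => // x y xn yn; rewrite gtn_max xn.
have L_end e v : mono_end c e (L e v) v.
  have nz : 0 < #|[pred j : 'I_n | mono_end c e j v]| by apply/card_gt0P; exists (Ordinal n0).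
  by rewrite /L; have [j mj ->] := eq_bigmax_cond (fun j : 'I_n => val j) nz.
case: (boolP [exists e, [exists v, mono_end c e n.-1 v]]) => [/existsP[e /existsP[v h]]|no].
  by exists e, v.
have L_step (u v : 'I_(n ^ r).+1) : u < v -> L (c u v) u < L (c u v) v.
  move=> uv; set e := c u v; have end_v : mono_end c e (L e u).+1 v.
    by apply/existsP; exists u; rewrite uv eqxx; exact: L_end.
  have lt : (L e u).+1 < n.
    rewrite ltn_neqAle L_lt andbT; apply: contraNneq no => E.
    apply/existsP; exists e; apply/existsP; exists v.
    have -> : n.-1 = L e u by lia.
    exact: mono_endW.
  exact: (leq_bigmax_cond (Ordinal lt) end_v).
pose F v : {ffun 'I_r -> 'I_n} := [ffun e => Ordinal (L_lt e v)].
have F_inj : injective F.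
  move=> u v /ffunP E; apply: val_inj.
  have E' e : L e u = L e v by have := E e; rewrite !ffunE => /(congr1 val).
  case: (ltngtP u v) => // /L_step; by rewrite E' ltnn.
have := leq_card F F_inj; by rewrite card_ffun !card_ord ltnn.
Qed.

(** * Lower bound for the size Ramsey number *)

From mathcomp Require Import all_classical all_reals all_analysis.
Require Import Defs.

Import Order.TTheory GRing.Theory Num.Theory.

(** Ensures that [size_ramsey] is a true minimum and not its default value 0, for which a lower
    bound would fail. *)
Lemma arrows_tournament (n r : nat) : 0 < n -> exists m, ramsey_size (dipath n) r m.
Proof.
move=> n0; pose G := @Digraph 'I_(n ^ r).+1 (fun i j => i < j).
exists #|edges G|, G; split=> //.
  by split => [u|u v] /=; [rewrite ltnn | case: (ltngtP u v)].
move=> c; have [e [w /mono_end_path[f [_ fP]]]] := tournament_mono_path c n0.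
exists e, (fun i : dipath n => f i); split; last first.
  move=> u v /= /eqP vu; rewrite vu; apply: fP; have := ltn_ord v; rewrite vu; lia.
have f_mono : {in gtn n &, {homo f : i j / i < j}}.
  move=> i j _ jn ij; rewrite inE in jn; elim: j ij jn => // j IH.
  rewrite ltnS leq_eqVlt => /predU1P[->|ij] jn.
    by apply: (fP j _).1; lia.
  by apply: ltn_trans (IH ij _) (fP j _).1; lia.
move=> i j fij; apply: val_inj; case: (ltngtP i j) => // ij.
  by have := f_mono i j (ltn_ord i) (ltn_ord j) ij; rewrite fij ltnn.
by have := f_mono j i (ltn_ord j) (ltn_ord i) ij; rewrite fij ltnn.
Qed.

Lemma leq_size_ramsey (H : digraph) (r b : nat) :
  (exists m, ramsey_size H r m) -> (forall m, ramsey_size H r m -> b <= m) ->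
  b <= size_ramsey H r.
Proof.
move=> ex le; apply: le.
suff /(xgetPex 0)[] : exists m, ramsey_size H r m /\ forall m', ramsey_size H r m' -> m <= m' by [].
have exb : exists m, `[< ramsey_size H r m >] by case: ex => m h; exists m; exact/asboolP.
case: (ex_minnP exb) => m /asboolP h min; exists m; split => // m' /asboolP; exact: min.
Qed.

Lemma size_ramsey_lower (R : realFieldType) (q n k t T N : nat) :
    0 < q -> 0 < k -> 0 < t -> 0 < T ->
    T * (16 * T ^ 2) ^ T.+1 < N -> 771 * N <= T * k ^ q -> 2 * T <= t ^ q.+1 ->
    q * k * t < n ->
  N ^ 2 <= size_ramsey (dipath n) q.+1.
Proof.
move=> q0 k0 t0 T0 hN hk ht hn.
have n0 : 0 < n by apply: leq_ltn_trans hn.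
apply: leq_size_ramsey => [|m [G [[irr asym] <- arr]]]; first exact: arrows_tournament.
rewrite leqNgt; apply/negP => /ltnW hm.
have [M [g [lab [b mono]]] TM] := covered_setT irr asym R T0 hN hm.
have cov : covered (@Defs.arc G) (t ^ q.+1) M [set: G]%SET.
  exists g, lab; split=> // u uT; have [gu lu] := b u uT; split => //.
  exact: leq_trans lu ht.
have Mk : M <= k ^ q by rewrite -(leq_pmul2l T0); exact: leq_trans TM hk.
have [c [phi [phi_lt phi_mono]]] := colouring_of_cover q0 k0 t0 cov Mk.
have [e [f [_ fP]]] := arr c.
(* The potential grows by at least 1 per arc, so it would reach n - 1 at the end of a monochromatic
   path, beyond its bound. *)
have le_phi (i : 'I_n) : i <= phi e (f i).
  case: i => i; elim: i => // i IH ni /=.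
  have [a ce] := fP (Ordinal (ltnW ni)) (Ordinal ni) (eqxx _).
  by apply: leq_ltn_trans (IH (ltnW ni)) _; have := phi_mono _ _ a; rewrite ce.
have ln : n.-1 < n by lia.
have := le_phi (Ordinal ln); have := phi_lt e (f (Ordinal ln)); rewrite /=; lia.
Qed.

(** With k about n / (qt) and T about t^(q+1) / 4, the largest admissible N, about T k^q / 771, has
    order n^q t. Roundings cost factors 2: 3084 = 4 * 771 and 12336 = 8 * 1542. *)
Lemma param_choice (q n t : nat) (T := t ^ q.+1 %/ 4) :
    0 < q -> 1 < t -> 3084 * q * t * (16 * T ^ 2) ^ T.+1 < n ->
  exists k N, [/\ 0 < k, 0 < T /\ 2 * T <= t ^ q.+1, T * (16 * T ^ 2) ^ T.+1 < N,
    771 * N <= T * k ^ q /\ q * k * t < n & n ^ q * t <= 12336 * (2 * q) ^ q * N].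
Proof.
move=> q0 t2; set A := _ ^ T.+1 => hn.
have t4 : 4 <= t ^ q.+1.
  by apply: (@leq_trans (2 ^ q.+1)); rewrite ?leq_exp2r // (@leq_exp2l 2 2).
have T0 : 0 < T by rewrite divn_gt0.
have T4 : 4 * T <= t ^ q.+1 by rewrite mulnC leq_divM.
have T8 : t ^ q.+1 <= 8 * T.
  have := ltn_ceil (t ^ q.+1) (isT : 0 < 4); rewrite -/T; lia.
have A0 : 0 < A by rewrite expn_gt0 muln_gt0 expn_gt0 T0.
have qt0 : 0 < q * t by rewrite muln_gt0 q0; lia.
pose k := n.-1 %/ (q * t).
have kn : q * t * k <= n.-1 by rewrite mulnC leq_divM.
have nk : n.-1 < q * t * k.+1 by rewrite mulnC ltn_ceil.
have k0 : 0 < k.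
  have : q * t <= 3084 * q * t * A.
    have -> : 3084 * q * t * A = q * t * (3084 * A) by ring.
    by rewrite leq_pmulr // muln_gt0.
  by rewrite divn_gt0 //; lia.
have n2k : n <= 2 * q * t * k.
  have : q * t * k.+1 <= q * t * (2 * k) by rewrite leq_mul2l; apply/orP; right; lia.
  have -> : q * t * (2 * k) = 2 * q * t * k by ring.
  by lia.
have Ak : 1542 * A < k.
  have : q * t * (3084 * A) < q * t * (2 * k).
    have -> : q * t * (3084 * A) = 3084 * q * t * A by ring.
    have -> : q * t * (2 * k) = 2 * q * t * k by ring.
    exact: leq_trans hn n2k.
  by rewrite ltn_pmul2l //; lia.
pose N := T * k ^ q %/ 771.
have Tk : T * (1542 * A) <= T * k ^ q.
  rewrite leq_mul2l; apply/orP; right; apply: leq_trans (ltnW Ak) _.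
  by rewrite -[X in X <= _]expn1 leq_pexp2l.
have NA : T * A < N.
  have TA : 0 < T * A by rewrite muln_gt0 T0.
  apply: (@leq_trans (2 * (T * A))); first by lia.
  by rewrite leq_divRL //; apply: leq_trans Tk; lia.
have Nk : T * k ^ q <= 1542 * N.
  have := ltn_ceil (T * k ^ q) (isT : 0 < 771); rewrite -/N; lia.
exists k, N; split => //.
- by split => //; lia.
- by split; [rewrite mulnC leq_divM | move: kn; rewrite -!mulnA (mulnC t k); lia].
have tq0 : 0 < t ^ q by rewrite expn_gt0; lia.
rewrite -(leq_pmul2l tq0).
apply: (@leq_trans ((2 * q * t * k) ^ q * t ^ q.+1)).
  by rewrite mulnCA expnSr leq_mul // leq_exp2r.
apply: (@leq_trans ((2 * q) ^ q * t ^ q * k ^ q * (8 * T))).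
  by rewrite !expnMn leq_mul2l T8 orbT.
have -> : (2 * q) ^ q * t ^ q * k ^ q * (8 * T) = (2 * q) ^ q * t ^ q * 8 * (T * k ^ q) by ring.
have -> : t ^ q * (12336 * (2 * q) ^ q * N) = (2 * q) ^ q * t ^ q * 8 * (1542 * N) by ring.
by rewrite leq_mul2l Nk orbT.
Qed.

(** * Logarithmic estimates and asymptotics *)

Local Open Scope ring_scope.

Lemma ln2_gt0 (R : realType) : 0 < ln 2 :> R.
Proof. by rewrite ln_gt0 // ltr1n. Qed.

Lemma log2_le_sqrt (R : realType) (x : R) : 0 < x -> log2 x <= 2 * Num.sqrt x / ln 2.
Proof.
move=> x0; rewrite /log2 ler_wpM2r ?invr_ge0 ?(ltW (ln2_gt0 R)) //.
have s0 : 0 < Num.sqrt x by rewrite sqrtr_gt0.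
rewrite -{1}(sqr_sqrtr (ltW x0)) lnXn // -[X in X <= _]mulr_natl ler_wpM2l //.
have := @le_ln1Dx R (Num.sqrt x - 1); rewrite addrCA subrr addr0 => le.
by apply: le_trans (le _) _; lra.
Qed.

Lemma ratio_ge (R : realType) (K x : R) : 0 < K -> 2 <= x -> (2 * K / ln 2) ^+ 2 <= x ->
  1 <= log2 x /\ K <= x / log2 x.
Proof.
move=> K0 x2 xK; have l2 := ln2_gt0 R; have x0 : 0 < x by lra.
have l1 : 1 <= log2 x by rewrite /log2 ler_pdivlMr // mul1r ler_ln ?posrE.
split => //; rewrite ler_pdivlMr; last by lra.
apply: le_trans (ler_wpM2l (ltW K0) (log2_le_sqrt x0)) _.
have s0 : 0 < Num.sqrt x by rewrite sqrtr_gt0.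
have sK : 2 * K / ln 2 <= Num.sqrt x.
  by rewrite -(ler_pXn2r (isT : (0 < 2)%N)) ?nnegrE ?sqr_sqrtr ?divr_ge0 ?mulr_ge0 // ltW.
have -> : K * (2 * Num.sqrt x / ln 2) = 2 * K / ln 2 * Num.sqrt x by ring.
by apply: le_trans (ler_wpM2r (ltW s0) sK) _; rewrite -expr2 sqr_sqrtr // ltW.
Qed.

(** Split n as [E * E]. One factor absorbs (4T)^(2T), because 2T log2 x <= x / 2; the other absorbs
    c x^3, because it is at least (x ln 2 / 8)^4. *)
Lemma power_lt (R : realType) (c x : R) (n t T : nat) :
    0 <= c -> x = log2 n%:R -> 2 <= x -> (c + 1) * (8 / ln 2) ^+ 4 <= x ->
    (0 < T)%N -> t%:R <= x -> (4 * T)%N%:R * log2 x <= x -> 1 <= log2 x ->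
  c * t%:R * ((16 * T ^ 2) ^ T.+1)%N%:R < n%:R.
Proof.
move=> c0 xE x2 xc T0 tx Tx l1; have l2 := ln2_gt0 R.
have x0 : 0 < x by lra.
have n0 : 0 < n%:R :> R.
  rewrite lt_def ler0n andbT; apply/eqP => n0.
  by move: x2; rewrite xE n0 /log2 ln0 ?mul0r // lern0.
have xln : x * ln 2 = ln n%:R by rewrite xE /log2 mulfVK // gt_eqF.
pose E : R := expR (ln n%:R / 2).
have nE : n%:R = E * E by rewrite -expRD -[LHS]lnK ?posrE //; congr expR; lra.
have E0 : 0 < E by exact: expR_gt0.
have pow_le : ((16 * T ^ 2) ^ T.+1)%N%:R <= E * x ^+ 2.
  have Tx' : (4 * T)%N%:R <= x.
    by apply: le_trans Tx; rewrite ler_peMr.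
  have -> : (16 * T ^ 2 = (4 * T) ^ 2)%N by rewrite expnMn.
  rewrite !natrX; apply: le_trans (_ : (x ^+ 2) ^+ T.+1 <= _).
    by rewrite lerXn2r ?nnegrE ?exprn_ge0 ?(ltW x0) // lerXn2r ?nnegrE ?(ltW x0).
  rewrite -exprM -[x in x ^+ (2 * _)]lnK ?posrE // -[x in _ * x ^+ 2]lnK ?posrE //.
  rewrite -!expRM_natl -expRD ler_expR natrM -[T.+1%:R]natr1.
  move: Tx; rewrite {1}/log2 natrM mulrA ler_pdivrMr // xln.
  lra.
have E_gt : c * x ^+ 3 < E.
  have yx : x * (ln 2 / 8) <= expR (ln n%:R / 8).
    by rewrite mulrA xln; apply: le_trans (expR_ge1Dx _); lra.
  have -> : E = expR (ln n%:R / 8) ^+ 4 by rewrite -expRM_natl /E; congr expR; lra.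
  have a0 : 0 < ln 2 / 8 :> R by lra.
  apply: lt_le_trans (_ : (x * (ln 2 / 8)) ^+ 4 <= _); last first.
    by rewrite lerXn2r ?nnegrE ?expR_ge0 // ltW // mulr_gt0.
  have -> : (x * (ln 2 / 8)) ^+ 4 = x ^+ 3 * (x * (ln 2 / 8) ^+ 4) by ring.
  rewrite mulrC ltr_pM2l ?exprn_gt0 //.
  rewrite -ltr_pdivrMr ?exprn_gt0 // -exprVn invf_div.
  apply: lt_le_trans xc; rewrite ltr_pM2r ?exprn_gt0 ?divr_gt0 //; lra.
rewrite nE; apply: le_lt_trans (_ : c * x ^+ 3 * E < _); last by rewrite ltr_pM2r.
have -> : c * x ^+ 3 * E = c * x * (E * x ^+ 2) by ring.
by apply: ler_pM; rewrite ?mulr_ge0 // ler_wpM2l.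
Qed.

Lemma powR_root (R : realType) (x : R) (q : nat) : (0 < q)%N -> 0 <= x ->
  (x `^ (1 / (2 * q)%:R)) ^+ (2 * q) = x.
Proof.
move=> q0 x0; rewrite -powR_mulrn ?powR_ge0 // -powRrM divfK ?powRr1 //.
by rewrite pnatr_eq0 muln_eq0 -lt0n.
Qed.

(** Here t is the integer part of X^(1/(2q)) with X = log n / log log n. Then t^(q+1) <= X as q + 1
    <= 2q, and X^(1/q) <= (t + 1)^2 <= 4 t^2. The summands of the threshold serve L >= 2, [ratio_ge]
    and [power_lt]. *)
Lemma exists_base (R : realType) (a q n : nat) : (0 < q)%N ->
    2 + (2 * 4 ^+ q / ln 2) ^+ 2 + (a%:R * q%:R + 1) * (8 / ln 2) ^+ 4 <= log2 (n%:R : R) ->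
  exists t : nat, [/\ (1 < t)%N,
    (log2 n%:R / log2 (log2 n%:R)) `^ (1 / q%:R) <= 4 * t%:R ^+ 2 :> R,
    0 <= log2 (n%:R : R), 1 <= log2 (log2 n%:R : R) &
    (a * q * t * (16 * (t ^ q.+1 %/ 4) ^ 2) ^ (t ^ q.+1 %/ 4).+1 < n)%N].
Proof.
move=> q0; set L := log2 n%:R => hL.
have l2 := ln2_gt0 R.
have p1 : 0 <= (2 * 4 ^+ q / ln 2) ^+ 2 :> R by rewrite exprn_ge0 // divr_ge0 ?mulr_ge0 ?exprn_ge0 // ltW.
have p2 : 0 <= (a%:R * q%:R + 1) * (8 / ln 2) ^+ 4 :> R.
  by rewrite mulr_ge0 ?exprn_ge0 ?divr_ge0 ?addr_ge0 ?mulr_ge0 ?ler0n // ltW.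
have L2 : 2 <= L by lra.
have [l1 X4] : 1 <= log2 L /\ 4 ^+ q <= L / log2 L.
  by apply: ratio_ge; rewrite ?exprn_gt0 //; lra.
set X := L / log2 L in X4 *.
have X0 : 0 <= X by apply: le_trans X4; rewrite exprn_ge0.
pose Y := X `^ (1 / (2 * q)%:R).
have YX : Y ^+ (2 * q) = X by exact: powR_root.
have Y0 : 0 <= Y by exact: powR_ge0.
have q20 : (0 < 2 * q)%N by rewrite muln_gt0.
have Y2 : 2 <= Y.
  by rewrite -(ler_pXn2r q20) ?nnegrE // YX exprM -natrX.
have XL : X <= L by rewrite ler_pdivrMr ?ler_peMr //; lra.
have tY : (Num.truncn Y)%:R <= Y by rewrite truncn_le.
have t2 : (1 < Num.truncn Y)%N by rewrite truncn_gt_nat.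
exists (Num.truncn Y); set t := Num.truncn Y in tY t2 *.
have tq1 : (t ^ q.+1)%N%:R <= X.
  rewrite natrX -YX; apply: (@le_trans _ _ (Y ^+ q.+1)); first by rewrite lerXn2r ?nnegrE.
  by apply: ler_weXn2l; [lra | rewrite mul2n -addnn -addn1 leq_add2l].
have L0 : 0 <= L by lra.
split=> //.
- have -> : X `^ (1 / q%:R) = Y ^+ 2.
    rewrite -powR_mulrn // -powRrM natrM; congr (_ `^ _); field.
    by rewrite pnatr_eq0 -lt0n.
  have := truncnS_gt Y; rewrite -/t -natr1 => Yt.
  have t1 : 1 <= t%:R :> R by rewrite ler1n ltnW.
  have -> : 4 * t%:R ^+ 2 = (2 * t%:R) ^+ 2 :> R by ring.
  by rewrite lerXn2r ?nnegrE ?mulr_ge0 //; lra.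
set T := (_ %/ 4)%N.
have T0 : (0 < T)%N.
  rewrite divn_gt0 //; apply: (@leq_trans (2 ^ q.+1)%N); last by rewrite leq_exp2r.
  by rewrite (@leq_exp2l 2 2).
have T4 : (4 * T)%N%:R <= X.
  by apply: le_trans tq1; rewrite ler_nat mulnC leq_divM.
rewrite -(ltr_nat R) natrM natrM natrM; apply: (@power_lt _ _ L) => //.
- by lra.
- apply: le_trans XL; apply: le_trans tq1; rewrite ler_nat -{1}[t]expn1.
  by rewrite leq_exp2l.
by rewrite -ler_pdivlMr //; lra.
Qed.

Local Open Scope classical_set_scope.
Local Open Scope ring_scope.

Theorem theorem1 (R : realType) (q : nat) (hq : (1 <= q)%N) :
  exists c1 : R, 0 < c1 /\
    \forall n \near \oo,
      c1 * n%:R ^+ (2 * q) * (log2 n%:R) `^ (1 / q%:R)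
        / (log2 (log2 n%:R)) `^ ((q%:R + 2) / q%:R)
      <= (size_ramsey (dipath n) q.+1)%:R.
Proof.
pose C : R := (12336 * (2 * q) ^ q)%N%:R.
have C0 : 0 < C by rewrite ltr0n muln_gt0 expn_gt0 muln_gt0 hq.
(* [C] comes from n^q t <= C N, squared because the bound is N^2; the 4 comes from 4 t^2 in
   [exists_base]. *)
exists (C ^- 2 / 4); split; first by rewrite divr_gt0 // invr_gt0 exprn_gt0.
pose L0 : R := 2 + (2 * 4 ^+ q / ln 2) ^+ 2 + (3084 * q%:R + 1) * (8 / ln 2) ^+ 4.
near=> n.
have l2 := ln2_gt0 R.
have hL : L0 <= log2 (n%:R : R).
  have nL : expR (L0 * ln 2) <= n%:R by near: n; exact: nbhs_infty_ger.
  rewrite /log2 ler_pdivlMr // -[leLHS]expRK ler_ln ?posrE ?expR_gt0 //.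
  exact: lt_le_trans (expR_gt0 _) nL.
have [t [t2 le_t L00 l1 hn]] := @exists_base R 3084 q n hq hL.
have [k [N [k0 [T0 ht] hN [hk kn] Nn]]] := param_choice hq t2 hn.
have := size_ramsey_lower R hq k0 (ltnW t2) T0 hN hk ht kn.
rewrite -(ler_nat R) natrX; apply: le_trans.
have {Nn} : n%:R ^+ q * t%:R <= C * N%:R by rewrite -natrX -!natrM ler_nat.
rewrite -ler_pdivrMl // => Nn.
have nt0 : 0 <= C^-1 * (n%:R ^+ q * t%:R) by rewrite !mulr_ge0 ?invr_ge0 ?exprn_ge0 // ltW.
apply: le_trans (_ : (C^-1 * (n%:R ^+ q * t%:R)) ^+ 2 <= _); last first.
  by rewrite lerXn2r ?nnegrE.
set L := log2 n%:R in hL le_t L00 l1 *; set l := log2 L in le_t l1 *.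
(* As l >= 1, raising the exponent of the denominator from 1 / q to (q + 2) / q only lowers the
   quotient. *)
have pow_le : L `^ (1 / q%:R) / l `^ ((q%:R + 2) / q%:R) <= 4 * t%:R ^+ 2.
  apply: le_trans le_t; have l0 : 0 < l by lra.
  rewrite powRM ?invr_ge0 ?(ltW l0) // ler_wpM2l ?powR_ge0 //.
  have -> : l^-1 `^ (1 / q%:R) = (l `^ (1 / q%:R))^-1.
    by rewrite -powR_inv1 ?(ltW l0) // -powRrM mulN1r powRN.
  rewrite lef_pV2 ?posrE ?powR_gt0 //; apply: ler_powR => //.
  by rewrite ler_wpM2r ?invr_ge0 //; have := ler0n R q; lra.
have c0 : 0 <= C ^- 2 / 4 * n%:R ^+ (2 * q).
  by rewrite !mulr_ge0 ?invr_ge0 ?exprn_ge0 // ltW.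
rewrite -mulrA; apply: le_trans (ler_wpM2l c0 pow_le) _.
rewrite mulnC exprM le_eqVlt; apply/orP; left; apply/eqP.
by clearbody C; field; rewrite gt_eqF.
Unshelve. all: by end_near.
Qed.
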